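(* Let $p$ be an odd prime and $\mathcal O$ a complete discrete valuation ring with maximal ideal generated by $p$ and perfect residue field, with unique Frobenius lift $\phi$. Let $d_1,d_2\in\mathcal O^\times$, $q_1=d_1\cdot1_2$, $q_2=d_2\cdot1_2$, and let $(\phi_1^{G'},\phi_2^{G'})$ be the Frobenius lifts attached to the Levi-Civita connection on $G'=GL_1^c=\mathrm{Spec}\,\mathcal O[\alpha,\beta,(\alpha^2+\beta^2)^{-1}]$ over $\mathcal O$ attached to $(q_1,q_2)$. Put $$\epsilon=\phi\left(\frac{d_2}{d_1}\right)\in\mathcal O^\times,\qquad \theta_i=\frac{d_i^p(\alpha^2+\beta^2)^p}{\phi(d_i)(\alpha^{2p}+\beta^{2p})}\in\mathcal O(\widehat{G'})^\times,\ i=1,2,$$ let $(v_1,v_2)$ be the unique solution in $p\mathcal O(\widehat{G'})\times p\mathcal O(\widehat{G'})$ of the system $$x_1^2-2\epsilon x_2+\epsilon^2x_2^2=\theta_1-1,\qquad x_1^2+2\epsilon x_1+\epsilon^2x_2^2=\epsilon^2(\theta_2-1)$$ in the unknowns $x_1,x_2$, and let $u_2:=1+\epsilon^{-1}v_1$, $u_1:=1-\epsilon v_2$. Then we have the following equality of matrices with coefficients in $\mathcal O(\widehat{G'})$: $$\phi_i^{G'}\begin{pmatrix}\alpha&\beta\\-\beta&\alpha\end{pmatrix}=\begin{pmatrix}\alpha^p&\beta^p\\-\beta^p&\alpha^p\end{pmatrix}\cdot\begin{pmatrix}u_i&v_i\\-v_i&u_i\end{pmatrix},\qquad i=1,2.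$$
   Context: For a matrix $a=(a_{ij})$, $a^t$ is the transpose and $a^{(p)}=(a_{ij}^p)$; set maps between rings are applied to matrices entrywise. A Frobenius lift on a ring $A$ is a ring endomorphism reducing mod $p$ to the $p$-power Frobenius of $A/pA$. On a $p$-torsion free ring a $p$-derivation $\delta$ is the same as a Frobenius lift $\phi$, via $\phi(a)=a^p+p\,\delta a$ (''attached''). $\widehat{\ }$ is $p$-adic completion. Let $x$ be a $2\times2$ matrix of indeterminates, $G=GL_2=\mathrm{Spec}\,\mathcal O[x,\det(x)^{-1}]$, $\mathcal O(\widehat G)=\mathcal O[x,\det(x)^{-1}]^{\widehat{\ }}$. A $p$-adic connection on $G$ is a $p$-derivation $\delta^G$ on $\mathcal O(\widehat G)$ extending that of $\mathcal O$, with attached Frobenius lift $\phi^G$. It is metric with respect to a symmetric $q\in GL_2(\mathcal O)$ if $\phi^G\circ\mathcal H_q=\mathcal H_q\circ\phi_0^G$, where $\mathcal H_q$ is the (continuous) $\mathcal O$-algebra endomorphism of $\mathcal O(\widehat G)$ with $x\mapsto x^tqx$ and $\phi_0^G$ is the Frobenius lift extending $\phi$ with $\phi_0^G(x)=x^{(p)}$. The Levi-Civita connection on $G$ attached to $(q_1,q_2)$ is the unique (it exists) pair $(\delta_1^G,\delta_2^G)$ of $p$-adic connections with $\delta_i^G$ metric with respect to $q_i$ and $\Gamma_{ijk}=\Gamma_{jik}$ for all $i,j,k\in\{1,2\}$, where $\Gamma_i=(\Gamma_{ijk})_{j,k}:=(\delta_i^Gx)^t\cdot\phi(q_i)\cdot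 x^{(p)}$. $G'=GL_1^c$ is embedded in $G$ via $x\mapsto\begin{pmatrix}\alpha&\beta\\-\beta&\alpha\end{pmatrix}$, and $\mathcal O(\widehat{G'})=\mathcal O[\alpha,\beta,(\alpha^2+\beta^2)^{-1}]^{\widehat{\ }}$. When $q_1,q_2$ are scalar matrices, the ideal of $\mathcal O(\widehat G)$ defining $\widehat{G'}$ is sent into itself by $\delta_1^G,\delta_2^G$; the induced pair $(\delta_1^{G'},\delta_2^{G'})$ of $p$-derivations on $\mathcal O(\widehat{G'})$ is called the Levi-Civita connection on $G'$ attached to $(q_1,q_2)$. *)

(* Defs.v *)
From HB Require Import structures.
From mathcomp Require Import all_boot all_order all_algebra.
From mathcomp Require Import generic_quotient fraction mpoly.
From mathcomp Require Import boolp.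

Set Implicit Arguments.
Unset Strict Implicit.
Unset Printing Implicit Defensive.

Import GRing.Theory.
Local Open Scope ring_scope.
Local Open Scope quotient_scope.

Definition pdvd (R : pzRingType) (p n : nat) (a : R) : Prop :=
  exists b : R, a = b *+ (p ^ n).

Section PDvd.
Variables (R : comPzRingType) (p n : nat).
Implicit Types a b : R.

Lemma pdvd0 : pdvd p n (0 : R).
Proof. by exists 0; rewrite mul0rn. Qed.

Lemma pdvdD a b : pdvd p n a -> pdvd p n b -> pdvd p n (a + b).
Proof. by move=> [c ->] [d ->]; exists (c + d); rewrite mulrnDl. Qed.

Lemma pdvdN a : pdvd p n a -> pdvd p n (- a).
Proof. by move=> [c ->]; exists (- c); rewrite mulNrn. Qed.

Lemma pdvdB a b : pdvd p n a -> pdvd p n b -> pdvd p n (a - b).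
Proof. by move=> ha hb; apply/pdvdD/pdvdN. Qed.

Lemma pdvdMl a b : pdvd p n b -> pdvd p n (a * b).
Proof. by move=> [c ->]; exists (a * c); rewrite mulrnAr. Qed.

Lemma pdvdM a a' b b' : pdvd p n (a - a') -> pdvd p n (b - b') ->
  pdvd p n (a * b - a' * b').
Proof.
move=> ha hb; have -> : a * b - a' * b' = a * (b - b') + b' * (a - a').
  by rewrite !mulrBr addrA [b' * a]mulrC [b' * a']mulrC subrK.
by apply: pdvdD; apply: pdvdMl.
Qed.

End PDvd.

(* Elements of lim_n A/p^n A, presented by representatives: [f n] represents
   the component in A/p^n A. *)
Definition pcoherent (A : pzRingType) (p : nat) (f : nat -> A) : Prop :=
  forall n, pdvd p n (f n.+1 - f n).

(* The map A -> lim_n A/p^n A is bijective. *)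
Definition padic_complete (p : nat) (A : pzRingType) : Prop :=
  forall f : nat -> A, pcoherent p f ->
    exists! a : A, forall n, pdvd p n (f n - a).

Section Completion.
Variables (p : nat) (A : comPzRingType).

Record cohseq := CohSeq { cohfun :> nat -> A; cohP : pcoherent p cohfun }.

HB.instance Definition _ := gen_eqMixin cohseq.
HB.instance Definition _ := gen_choiceMixin cohseq.

Implicit Types f g h : cohseq.

Fact const_coh (a : A) : pcoherent p (fun _ => a).
Proof. by move=> n; rewrite subrr; apply: pdvd0. Qed.
Fact add_coh f g : pcoherent p (fun n => f n + g n).
Proof. by move=> n; rewrite opprD addrACA; apply: pdvdD; apply: cohP. Qed.
Fact opp_coh f : pcoherent p (fun n => - f n).
Proof. by move=> n; rewrite -opprD; apply/pdvdN/cohP. Qed.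
Fact mul_coh f g : pcoherent p (fun n => f n * g n).
Proof. by move=> n; apply: pdvdM; apply: cohP. Qed.

Definition coh_const a := CohSeq (const_coh a).
Definition coh_add f g := CohSeq (add_coh f g).
Definition coh_opp f := CohSeq (opp_coh f).
Definition coh_mul f g := CohSeq (mul_coh f g).

Definition coh_equiv f g : bool := `[< forall n, pdvd p n (f n - g n) >].

Fact coh_equiv_refl : reflexive coh_equiv.
Proof. by move=> f; apply/asboolP => n; rewrite subrr; apply: pdvd0. Qed.
Fact coh_equiv_sym : ssrbool.symmetric coh_equiv.
Proof.
by move=> f g; apply/asboolP/asboolP => h n; rewrite -opprB; apply: pdvdN.
Qed.
Fact coh_equiv_trans : transitive coh_equiv.
Proof.
move=> g f h /asboolP fg /asboolP gh; apply/asboolP => n.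
by rewrite -(subrK (g n) (f n)) -addrA; apply: pdvdD.
Qed.
Canonical coh_equiv_rel :=
  EquivRel coh_equiv coh_equiv_refl coh_equiv_sym coh_equiv_trans.

Definition completion := {eq_quot coh_equiv}.
HB.instance Definition _ : EqQuotient _ coh_equiv completion :=
  EqQuotient.on completion.
HB.instance Definition _ := Choice.on completion.

Definition cpi (f : cohseq) : completion := \pi_completion f.

Lemma cpiP f g : (forall n, pdvd p n (f n - g n)) <-> cpi f = cpi g.
Proof.
split=> [h|/eqP]; first by apply/eqP; rewrite eqmodE; apply/asboolP.
by rewrite eqmodE => /asboolP.
Qed.

Lemma cpi_repr (x : completion) : cpi (repr x) = x.
Proof. exact: reprK. Qed.

Lemma cpiW (P : completion -> Prop) : (forall f, P (cpi f)) -> forall x, P x.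
Proof. by move=> h x; rewrite -[x]cpi_repr. Qed.

Definition c_zero := cpi (coh_const 0).
Definition c_one := cpi (coh_const 1).
Definition c_opp (x : completion) := cpi (coh_opp (repr x)).
Definition c_add (x y : completion) := cpi (coh_add (repr x) (repr y)).
Definition c_mul (x y : completion) := cpi (coh_mul (repr x) (repr y)).

Lemma c_oppE f : c_opp (cpi f) = cpi (coh_opp f).
Proof.
apply/cpiP => n /=; rewrite -opprD; apply/pdvdN.
by move: n; apply/cpiP; rewrite cpi_repr.
Qed.
Lemma c_addE f g : c_add (cpi f) (cpi g) = cpi (coh_add f g).
Proof.
apply/cpiP => n /=; rewrite opprD addrACA.
by apply: pdvdD; move: n; apply/cpiP; rewrite cpi_repr.
Qed.
Lemma c_mulE f g : c_mul (cpi f) (cpi g) = cpi (coh_mul f g).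
Proof.
by apply/cpiP => n /=; apply: pdvdM; move: n; apply/cpiP; rewrite cpi_repr.
Qed.

Let cpi_ext f g : cohfun f =1 cohfun g -> cpi f = cpi g.
Proof. by move=> h; apply/cpiP => n; rewrite h subrr; apply: pdvd0. Qed.

Fact c_addA : associative c_add.
Proof.
elim/cpiW=> f; elim/cpiW=> g; elim/cpiW=> h; rewrite !c_addE.
by apply: cpi_ext => n /=; rewrite addrA.
Qed.
Fact c_addC : commutative c_add.
Proof.
elim/cpiW=> f; elim/cpiW=> g; rewrite !c_addE.
by apply: cpi_ext => n /=; rewrite addrC.
Qed.
Fact c_add0 : left_id c_zero c_add.
Proof. by elim/cpiW=> f; rewrite c_addE; apply: cpi_ext => n /=; rewrite add0r. Qed.
Fact c_addN : left_inverse c_zero c_opp c_add.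
Proof.
by elim/cpiW=> f; rewrite c_oppE c_addE; apply: cpi_ext => n /=; rewrite addNr.
Qed.
HB.instance Definition _ :=
  GRing.isZmodule.Build completion c_addA c_addC c_add0 c_addN.

Fact c_mulA : associative c_mul.
Proof.
elim/cpiW=> f; elim/cpiW=> g; elim/cpiW=> h; rewrite !c_mulE.
by apply: cpi_ext => n /=; rewrite mulrA.
Qed.
Fact c_mulC : commutative c_mul.
Proof.
elim/cpiW=> f; elim/cpiW=> g; rewrite !c_mulE.
by apply: cpi_ext => n /=; rewrite mulrC.
Qed.
Fact c_mul1 : left_id c_one c_mul.
Proof. by elim/cpiW=> f; rewrite c_mulE; apply: cpi_ext => n /=; rewrite mul1r. Qed.
Fact c_mulDl : left_distributive c_mul c_add.
Proof.
elim/cpiW=> f; elim/cpiW=> g; elim/cpiW=> h; rewrite !(c_mulE, c_addE).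
by apply: cpi_ext => n /=; rewrite mulrDl.
Qed.
HB.instance Definition _ :=
  GRing.Zmodule_isComPzRing.Build completion c_mulA c_mulC c_mul1 c_mulDl.

Definition to_completion (a : A) : completion := cpi (coh_const a).

Fact to_completion_is_zmod_morphism : zmod_morphism to_completion.
Proof.
move=> a b; rewrite /to_completion.
rewrite [RHS](_ : _ = c_add (cpi (coh_const a)) (c_opp (cpi (coh_const b)))) //.
by rewrite c_oppE c_addE; apply: cpi_ext.
Qed.
Fact to_completion_is_monoid_morphism : monoid_morphism to_completion.
Proof.
split=> // a b; rewrite /to_completion.
rewrite [RHS](_ : _ = c_mul (cpi (coh_const a)) (cpi (coh_const b))) //.
by rewrite c_mulE; apply: cpi_ext.
Qed.
HB.instance Definition _ :=
  GRing.isZmodMorphism.Build A completion to_completion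
    to_completion_is_zmod_morphism.
HB.instance Definition _ :=
  GRing.isMonoidMorphism.Build A completion to_completion
    to_completion_is_monoid_morphism.

End Completion.

(* A[1/s] for a domain A, as a subring of the fraction field of A. *)
Section Localization.
Variables (A : idomainType) (s : A).

Definition in_loc : {pred {fraction A}} :=
  fun x => `[< exists (f : A) (n : nat), x = tofrac f / tofrac s ^+ n >].

Fact in_loc_subring : subring_closed in_loc.
Proof.
have [s0|s0] := eqVneq s 0.
  have invs n : (tofrac s ^+ n)^-1 = tofrac (s ^+ n).
    by rewrite s0 tofrac0; case: n => [|n]; rewrite ?expr0 ?invr1 ?tofrac1 //
       exprS mul0r invr0 expr0n tofrac0.
  have E x : reflect (exists f, x = tofrac f) (x \in in_loc).
    apply: (iffP (asboolP _)) => [[f [n ->]]|[f ->]].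
      by exists (f * s ^+ n); rewrite invs -tofracM.
    by exists f, 0%N; rewrite expr0 divr1.
  split; first by apply/E; exists 1; rewrite tofrac1.
    move=> _ _ /E[f ->] /E[g ->]; apply/E.
    by exists (f - g); rewrite tofracB.
  move=> _ _ /E[f ->] /E[g ->]; apply/E.
  by exists (f * g); rewrite tofracM.
have sn n : tofrac s ^+ n != 0 by rewrite expf_neq0 // tofrac_eq0.
split.
- by apply/asboolP; exists 1, 0%N; rewrite expr0 divr1 tofrac1.
- move=> _ _ /asboolP[f [n ->]] /asboolP[g [m ->]]; apply/asboolP.
  exists (f * s ^+ m - g * s ^+ n), (n + m)%N.
  by rewrite -mulNr addf_div // mulNr tofracB !tofracM !tofracXn exprD.
- move=> _ _ /asboolP[f [n ->]] /asboolP[g [m ->]]; apply/asboolP.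
  by exists (f * g), (n + m)%N; rewrite mulf_div tofracM exprD.
Qed.
HB.instance Definition _ := GRing.isSubringClosed.Build {fraction A} in_loc
  in_loc_subring.

Record loc := Loc { loc_val : {fraction A}; _ : loc_val \in in_loc }.
HB.instance Definition _ := [isSub for loc_val].
HB.instance Definition _ := [Choice of loc by <:].
HB.instance Definition _ := [SubChoice_isSubComNzRing of loc by <:].

Fact to_loc_subproof (a : A) : tofrac a \in in_loc.
Proof. by apply/asboolP; exists a, 0%N; rewrite expr0 divr1. Qed.
Definition to_loc (a : A) : loc := Loc (to_loc_subproof a).

Fact to_loc_is_zmod_morphism : zmod_morphism to_loc.
Proof. by move=> a b; apply: val_inj; rewrite rmorphB /= tofracB. Qed.
Fact to_loc_is_monoid_morphism : monoid_morphism to_loc.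
Proof.
by split=> [|a b]; apply: val_inj; rewrite (rmorph1, rmorphM) /= (tofrac1, tofracM).
Qed.
HB.instance Definition _ :=
  GRing.isZmodMorphism.Build A loc to_loc to_loc_is_zmod_morphism.
HB.instance Definition _ :=
  GRing.isMonoidMorphism.Build A loc to_loc to_loc_is_monoid_morphism.

End Localization.

Definition is_ideal (R : comPzRingType) (I : R -> Prop) : Prop :=
  [/\ I 0, (forall a b, I a -> I b -> I (a + b)) & (forall a b, I b -> I (a * b))].

(* A DVR is a local PID that is not a field; here the maximal ideal, i.e. the
   set of nonunits, is generated by p. *)
Record complete_dvr (p : nat) (O : idomainType) : Prop := CompleteDVR {
  cdvr_pid : forall I : O -> Prop, is_ideal I ->
    exists c, forall a, I a <-> exists b, a = b * c;
  cdvr_local : forall a : O, a \isn't a GRing.unit <-> pdvd p 1 a;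
  cdvr_not_field : p%:R != 0 :> O;
  cdvr_complete : padic_complete p O;
}.

(* The Frobenius of the field O/pO is surjective. *)
Definition perfect_residue_field (p : nat) (O : pzRingType) : Prop :=
  forall a : O, exists b : O, pdvd p 1 (a - b ^+ p).

Definition frobenius_lift (p : nat) (R : pzRingType) (phi : {rmorphism R -> R}) :
  Prop := forall a : R, pdvd p 1 (phi a - a ^+ p).

(* (X^p + Y^p - (X + Y)^p) / p, which has integer coefficients *)
Definition Cp (p : nat) (R : pzRingType) (a b : R) : R :=
  - \sum_(1 <= k < p) (a ^+ (p - k) * b ^+ k) *+ ('C(p, k) %/ p).

Definition p_derivation (p : nat) (R : pzRingType) (delta : R -> R) : Prop :=
  [/\ delta 1 = 0,
      forall a b, delta (a + b) = delta a + delta b + Cp p a b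
    & forall a b, delta (a * b) =
        a ^+ p * delta b + b ^+ p * delta a + (delta a * delta b) *+ p].

Definition frob (p : nat) (R : pzRingType) (delta : R -> R) (a : R) : R :=
  a ^+ p + delta a *+ p.

Section Frob.
Variables (p : nat) (R : comPzRingType) (delta : R -> R).
Hypotheses (p_pr : prime p) (hdelta : p_derivation p delta).

Lemma frobD a b : frob p delta (a + b) = frob p delta a + frob p delta b.
Proof.
case: hdelta => _ hD _; rewrite /frob hD.
suff -> : (a + b) ^+ p = a ^+ p + b ^+ p - Cp p a b *+ p.
  rewrite !mulrnDl [_ *+ p + _ + _]addrC addrA subrK.
  by rewrite addrACA.
rewrite /Cp mulNrn opprK -sumrMnl exprDn -(big_mkord xpredT
  (fun i => a ^+ (p - i) * b ^+ i *+ 'C(p, i))).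
case: p p_pr => [|[|q]] // q_pr.
rewrite big_nat_recr //= big_ltn // subn0 subnn bin0 binn !expr0 mulr1 mul1r.
rewrite !mulr1n addrAC; congr (_ + _).
apply: eq_big_nat => k /andP[k0 kp]; rewrite -mulrnA divnK //.
by apply: prime_dvd_bin => //; rewrite k0.
Qed.

Lemma frobM a b : frob p delta (a * b) = frob p delta a * frob p delta b.
Proof.
case: hdelta => _ _ hM; rewrite /frob hM exprMn mulrDl !mulrDr !mulrnDl.
rewrite -!addrA; congr (_ + _); rewrite !mulrnAr !mulrnAl; congr (_ + _).
by rewrite [b ^+ p * _]mulrC.
Qed.

Lemma frob1 : frob p delta 1 = 1.
Proof. by case: hdelta => h1 _ _; rewrite /frob h1 mul0rn addr0 expr1n. Qed.

End Frob.

Definition frob_mx (p : nat) (R : pzRingType) m n (a : 'M[R]_(m, n)) :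
  'M[R]_(m, n) := map_mx (fun c => c ^+ p) a.

Section G.
Variables (p : nat) (O : idomainType).

Definition Gpoly_x : 'M[{mpoly O[2 * 2]}]_2 := \matrix_(i, j) 'X_(mxvec_index i j).

Definition OG : comPzRingType := completion p (loc (\det Gpoly_x)).

Definition poly_OG (f : {mpoly O[2 * 2]}) : OG :=
  to_completion p (to_loc (\det Gpoly_x) f).
Definition iotaG (c : O) : OG := poly_OG c%:MP.
Definition xG : 'M[OG]_2 := map_mx poly_OG Gpoly_x.

Variables (phi : {rmorphism O -> O}) (deltaO : O -> O).

Definition padic_connection (delta : OG -> OG) : Prop :=
  p_derivation p delta /\ forall c, delta (iotaG c) = iotaG (deltaO c).

(* Continuity is automatic, since H maps p^n OG into itself. *)
Definition is_Hq (q : 'M[O]_2) (H : {rmorphism OG -> OG}) : Prop :=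
  (forall c, H (iotaG c) = iotaG c) /\
  map_mx H xG = xG^T *m map_mx iotaG q *m xG.

Definition is_phi0 (phi0 : {rmorphism OG -> OG}) : Prop :=
  [/\ frobenius_lift p phi0,
      forall c, phi0 (iotaG c) = iotaG (phi c)
    & map_mx phi0 xG = frob_mx p xG].

Definition metric (q : 'M[O]_2) (delta : OG -> OG) : Prop :=
  exists H phi0 : {rmorphism OG -> OG}, [/\ is_Hq q H, is_phi0 phi0
    & forall f, frob p delta (H f) = H (phi0 f)].

Definition Gamma (q : 'M[O]_2) (delta : OG -> OG) : 'M[OG]_2 :=
  (map_mx delta xG)^T *m map_mx (fun c => iotaG (phi c)) q *m frob_mx p xG.

(* The indices 1, 2 are encoded as the elements 0, 1 of 'I_2. *)
Definition levi_civita_G (q : 'I_2 -> 'M[O]_2) (delta : 'I_2 -> OG -> OG) : Prop :=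
  [/\ forall i, padic_connection (delta i),
      forall i, metric (q i) (delta i)
    & forall i j k : 'I_2,
        Gamma (q i) (delta i) j k = Gamma (q j) (delta j) i k].

Definition mx_c (R : pzRingType) (a b : R) : 'M[R]_2 :=
  \matrix_(i, j) if i == j then a else if i == 0 then b else - b.

Definition G'poly_norm : {mpoly O[2]} := 'X_0 ^+ 2 + 'X_1 ^+ 2.

Definition OG' : comPzRingType := completion p (loc G'poly_norm).

Definition poly_OG' (f : {mpoly O[2]}) : OG' :=
  to_completion p (to_loc G'poly_norm f).
Definition iotaG' (c : O) : OG' := poly_OG' c%:MP.
Definition alphaG' : OG' := poly_OG' 'X_0.
Definition betaG' : OG' := poly_OG' 'X_1.

Definition is_restriction (res : {rmorphism OG -> OG'}) : Prop :=
  (forall c, res (iotaG c) = iotaG' c) /\ map_mx res xG = mx_c alphaG' betaG'.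

Definition levi_civita_G' (q : 'I_2 -> 'M[O]_2) (delta' : 'I_2 -> OG' -> OG') :
  Prop :=
  (forall i, p_derivation p (delta' i)) /\
  exists (delta : 'I_2 -> OG -> OG) (res : {rmorphism OG -> OG'}),
    [/\ levi_civita_G q delta, is_restriction res
      & forall i f, delta' i (res f) = res (delta i f)].

End G.

Definition invertible (R : comPzRingType) (a : R) : Prop := exists b, a * b = 1.

(* A completion may be the zero ring for general A and p, so it carries no
   unitRingType structure; rinv a is the inverse of a, or 0 if there is none. *)
Definition rinv (R : comPzRingType) (a : R) : R :=
  if pselect (invertible a) is left h then sval (cid h) else 0.

Lemma rinvP (R : comPzRingType) (a : R) : invertible a -> a * rinv a = 1.
Proof. by rewrite /rinv; case: pselect => // h _; case: cid. Qed.

Section Theta.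
Variables (p : nat) (O : idomainType) (phi : {rmorphism O -> O}).

Local Notation OG' := (OG' p O).
Local Notation iota := (@iotaG' p O).
Local Notation alpha := (alphaG' p O).
Local Notation beta := (betaG' p O).

Definition theta_den (d : O) : OG' :=
  iota (phi d) * (alpha ^+ (2 * p) + beta ^+ (2 * p)).

Definition theta (d : O) : OG' :=
  iota (d ^+ p) * (alpha ^+ 2 + beta ^+ 2) ^+ p * rinv (theta_den d).

(* v = (x_1, x_2) is a solution in (p OG') x (p OG') of the system. *)
Definition is_solution (d1 d2 : O) (v : OG' * OG') : Prop :=
  let e := iota (phi (d2 / d1)) in
  let x1 := v.1 in let x2 := v.2 in
  [/\ pdvd p 1 x1, pdvd p 1 x2,
      x1 ^+ 2 - 2%:R * e * x2 + e ^+ 2 * x2 ^+ 2 = theta d1 - 1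
    & x1 ^+ 2 + 2%:R * e * x1 + e ^+ 2 * x2 ^+ 2 = e ^+ 2 * (theta d2 - 1)].

End Theta.

(* Main.v *)
(* On G' a pair of Frobenius lifts is given by phi_i(c) = c^(p) W_i with
   c = mx_c alpha beta and W_i = mx_c u_i v_i congruent to 1 modulo p, since
   det c^(p) = alpha^2p + beta^2p is congruent to (alpha^2 + beta^2)^p.
   Restricting to G', metricity becomes u_i^2 + v_i^2 = theta_i, while the
   symmetry of Gamma, multiplied by p, becomes v_1 = eps (u_2 - 1) and
   u_1 - 1 = - eps v_2.  Eliminating u_1, u_2 yields the quadratic system, so
   (v_1, v_2) is a solution; two solutions h apart satisfy
   2 eps (h_1 + h_2) = 0 and (2 eps + p(...)) h_1 = 0, and elements congruent
   to units modulo p are units. *)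
From HB Require Import structures.
Require Import Defs.
From mathcomp Require Import all_boot all_order all_algebra.
From mathcomp Require Import fraction mpoly boolp ring.

Set Implicit Arguments.
Unset Strict Implicit.
Unset Printing Implicit Defensive.

Import GRing.Theory.
Local Open Scope ring_scope.

(** * Invertible elements and congruences modulo powers of [p] *)

Section Invertible.
Variable R : comPzRingType.
Implicit Types a b c : R.

Lemma invertibleM a b : invertible a -> invertible b -> invertible (a * b).
Proof.
by move=> [a' ha] [b' hb]; exists (a' * b'); rewrite mulrACA ha hb mulr1.
Qed.

Lemma invertibleX a n : invertible a -> invertible (a ^+ n).
Proof. by move=> [a' ha]; exists (a' ^+ n); rewrite -exprMn ha expr1n. Qed.

Lemma invertible_rinv a : invertible a -> invertible (rinv a).
Proof. by move=> ha; exists a; rewrite mulrC rinvP. Qed.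

Lemma invertible_rmorph (S : comPzRingType) (f : {rmorphism S -> R}) (x : S) :
  invertible x -> invertible (f x).
Proof. by move=> [y hxy]; exists (f y); rewrite -rmorphM hxy rmorph1. Qed.

Lemma invertible_mulI a b c : invertible a -> a * b = a * c -> b = c.
Proof.
by move=> [a' ha] e; rewrite -[b]mul1r -[c]mul1r -ha !(mulrC a a') -!mulrA e.
Qed.

Lemma pdvdX p n a : pdvd p 1 a -> pdvd p n (a ^+ n).
Proof.
move=> [b ->]; rewrite expn1 -mulr_natr exprMn -natrX mulr_natr.
by exists (b ^+ n).
Qed.

Lemma pdvdX_sub p n a b k : pdvd p n (a - b) -> pdvd p n (a ^+ k - b ^+ k).
Proof.
move=> h; elim: k => [|k IH]; first by rewrite subrr; apply: pdvd0.
by rewrite !exprS; apply: pdvdM.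
Qed.

End Invertible.

(** * Units of a p-adic completion *)

Section CompletionInvertible.
Variables (p : nat) (A : comPzRingType).
Local Notation C := (completion p A).

Lemma cpi1 : cpi (coh_const p (1 : A)) = 1 :> C. Proof. by []. Qed.
Lemma cpiM (f g : cohseq p A) : cpi f * cpi g = cpi (coh_mul f g) :> C.
Proof. exact: c_mulE. Qed.
Lemma cpiB (f g : cohseq p A) : cpi f - cpi g = cpi (coh_add f (coh_opp g)) :> C.
Proof. by rewrite -c_addE -c_oppE. Qed.

(** Partial sums of the geometric series for 1/(1 - p f), with length growing with the degree: the
    extra term at [n.+1] is the [n]-th power of a multiple of [p], and the earlier terms change only
    by coherence of [f]. *)
Fact geom_coh (f : cohseq p A) :
  pcoherent p (fun n => \sum_(k < n) (f n *+ p) ^+ k).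
Proof.
move=> n; rewrite big_ord_recr /= addrAC -sumrB; apply: pdvdD; last first.
  by apply: pdvdX; exists (f n.+1); rewrite expn1.
apply: (big_ind (pdvd p n)) => [||k _]; [exact: pdvd0|exact: pdvdD|].
apply: pdvdX_sub; rewrite -mulrnBl -mulr_natl; exact/pdvdMl/cohP.
Qed.

(** The geometric series is the inverse: in degree [n] the product misses 1 by [(f n *+ p) ^+ n], a
    multiple of [p ^ n]. *)
Lemma invertible_one_sub (x : C) : invertible (1 - x *+ p).
Proof.
rewrite -mulr_natr; elim/cpiW: x => f; exists (cpi (CohSeq (geom_coh f))).
have -> : p%:R = cpi (coh_const p (p%:R : A)) :> C.
  exact: (esym (rmorph_nat (to_completion p (A:=A)) p)).
rewrite -cpi1 cpiM cpiB cpiM; apply/cpiP => n /=.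
rewrite mulr_natr -[1 - _]opprB mulNr -subrX1 opprB addrAC subrr add0r.
by apply/pdvdN/pdvdX; exists (f n); rewrite expn1.
Qed.

Lemma invertible_pdvd (x y : C) :
  invertible y -> pdvd p 1 (x - y) -> invertible x.
Proof.
move=> [z hyz] [w]; rewrite expn1 => hw.
have -> : x = y * (1 - (- (z * w)) *+ p).
  by rewrite mulNrn opprK mulrDr mulr1 -mulrnAr mulrA hyz mul1r -hw addrC subrK.
by apply: invertibleM; [exists z|apply: invertible_one_sub].
Qed.

End CompletionInvertible.

(** For scalar [q], both the image of x under H_q and the matrix [Gamma] have this shape. *)
Lemma tr_mul_scalar_mulE (R : comPzRingType) (X Y : 'M[R]_2) (c : R) j k :
  (X^T *m c%:M *m Y) j k = c * (X 0 j * Y 0 k + X 1 j * Y 1 k).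
Proof.
rewrite mul_mx_scalar -scalemxAl mxE; congr (c * _).
rewrite !mxE !big_ord_recl big_ord0 !mxE addr0.
by have -> : lift ord0 ord0 = 1 :> 'I_2 by apply: val_inj.
Qed.

(** * Frobenius lifts attached to p-derivations *)

Section Frob.
Variables (p : nat) (R : comPzRingType) (delta : R -> R).
Hypotheses (p_pr : prime p) (hdelta : p_derivation p delta).
Implicit Types a b : R.

Lemma frobN a : frob p delta (- a) = - frob p delta a.
Proof.
have f0 : frob p delta 0 = 0.
  by apply: (addrI (frob p delta 0)); rewrite addr0 -frobD // addr0.
by apply: (addrI (frob p delta a)); rewrite -frobD // !subrr.
Qed.

Lemma delta_mulp a : delta a *+ p = frob p delta a - a ^+ p.
Proof. by rewrite /frob addrC addKr. Qed.

(** Serves for the entry [- beta] of [mx_c]; oddness of [p] gives [(- a) ^+ p = - a ^+ p]. *)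
Lemma delta_oppr_mulp a :
  odd p -> delta (- a) *+ p = - (frob p delta a - a ^+ p).
Proof.
by move=> p_odd; rewrite delta_mulp frobN exprNn -signr_odd p_odd mulN1r opprB
  opprK addrC.
Qed.

Lemma frob_pdvd a : pdvd p 1 (frob p delta a - a ^+ p).
Proof. by exists (delta a); rewrite /frob addrC addKr expn1. Qed.

(** Follows from additivity of [frob]: the quotient by [p] is the defect of additivity of
    [delta]. *)
Lemma expp_add_pdvd a b : pdvd p 1 ((a + b) ^+ p - (a ^+ p + b ^+ p)).
Proof.
have := frobD p_pr hdelta a b; rewrite /frob addrACA -mulrnDl => e.
exists (delta a + delta b - delta (a + b)).
rewrite expn1 mulrnBl; apply/(addIr (delta (a + b) *+ p)).
by rewrite subrK addrAC e addrC addKr.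
Qed.

End Frob.

Lemma odd_natr2_unit (p : nat) (O : idomainType) :
  odd p -> complete_dvr p O -> (2%:R : O) \is a GRing.unit.
Proof.
move=> p_odd hO; apply: contraT => /(cdvr_local hO)[b hb].
have : (1 : O) \isn't a GRing.unit.
  (* If 2 = p b, then 1 = p - 2 [p./2] = p (1 - b [p./2]), as [p] is odd. *)
  apply/(cdvr_local hO); exists (1 - b *+ p./2); rewrite expn1.
  rewrite mulrnBl -mulrnA mulnC mulrnA -[p in b *+ p]expn1 -hb.
  rewrite -[in X in X - _](odd_double_half p) p_odd mulrnDr.
  by rewrite -mulrnA mul2n addrK.
by rewrite unitr1.
Qed.

(** * Units of the coordinate ring of the completed G' *)

Section G'.
Variables (p : nat) (O : idomainType).
Local Notation OG' := (OG' p O).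
Local Notation iota := (@iotaG' p O).
Local Notation alpha := (alphaG' p O).
Local Notation beta := (betaG' p O).

HB.instance Definition _ := GRing.RMorphism.copy (@poly_OG p O)
  (to_completion p (A:=_) \o to_loc (\det (Gpoly_x O))).
HB.instance Definition _ := GRing.RMorphism.copy (@iotaG p O)
  (@poly_OG p O \o mpolyC (2 * 2) (R:=O)).
HB.instance Definition _ := GRing.RMorphism.copy (@poly_OG' p O)
  (to_completion p (A:=_) \o to_loc (G'poly_norm O)).
HB.instance Definition _ := GRing.RMorphism.copy (@iotaG' p O)
  (@poly_OG' p O \o mpolyC 2 (R:=O)).

Lemma G'poly_norm_neq0 : G'poly_norm O != 0.
Proof.
(* The value at the point (1, 0) is 1. *)
apply/eqP => /(congr1 (fun f => f.@[fun i => (i == 0)%:R])).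
rewrite meval0 /G'poly_norm mevalD !rmorphXn /= !mevalXU expr1n expr0n addr0.
exact/eqP/oner_neq0.
Qed.

Lemma invertible_norm : invertible (alpha ^+ 2 + beta ^+ 2).
Proof.
have -> : alpha ^+ 2 + beta ^+ 2 = poly_OG' p (G'poly_norm O).
  by rewrite rmorphD !rmorphXn.
apply: (invertible_rmorph (to_completion p (A:=_))); set s := G'poly_norm O.
(* The inverse already lives in the localization. That [s] is nonzero matters below, since 0 has
   inverse 0 in the fraction field. *)
have hs : (tofrac s)^-1 \in in_loc s.
  by apply/asboolP; exists 1, 1%N; rewrite tofrac1 mul1r expr1.
exists (Loc hs); apply: val_inj => /=.
by rewrite divff // tofrac_eq0 G'poly_norm_neq0.
Qed.

Lemma invertible_iota (c : O) : c \is a GRing.unit -> invertible (iota c).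
Proof. by move=> hc; apply: invertible_rmorph; exists c^-1; rewrite divrr. Qed.

Lemma iota_mulV (c : O) : c \is a GRing.unit -> iota c * iota c^-1 = 1.
Proof. by move=> hc; rewrite -rmorphM divrr // rmorph1. Qed.

Lemma invertible_normp (delta : OG' -> OG') :
  prime p -> p_derivation p delta ->
  invertible (alpha ^+ (2 * p) + beta ^+ (2 * p)).
Proof.
move=> p_pr hd; apply: (invertible_pdvd (y := (alpha ^+ 2 + beta ^+ 2) ^+ p)).
  exact/invertibleX/invertible_norm.
by rewrite -opprB !exprM; apply/pdvdN/(expp_add_pdvd p_pr hd).
Qed.

(** * Uniqueness for the quadratic system *)

Section Uniqueness.
Variable phi : {rmorphism O -> O}.
Hypotheses (p_odd : odd p) (hO : complete_dvr p O).

Lemma solution_uniq (d1 d2 : O) (v w : OG' * OG') :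
  d1 \is a GRing.unit -> d2 \is a GRing.unit ->
  is_solution phi d1 d2 v -> is_solution phi d1 d2 w -> v = w.
Proof.
move=> hd1 hd2.
case: v => x1 x2; case: w => y1 y2; rewrite /is_solution /=.
set e := iota _ => -[px1 px2 ex1 ex2] [py1 py2 ey1 ey2].
have h2e : invertible (2%:R * e).
  apply: invertibleM; last first.
    by apply/invertible_iota/rmorph_unit; rewrite unitrM unitrV hd1 hd2.
  by rewrite -(rmorph_nat iota); apply/invertible_iota/(odd_natr2_unit p_odd hO).
(* Subtracting the first equation from the second cancels the squares and leaves 2 e (x1 + x2),
   which the right-hand sides determine. *)
have hs : x1 - y1 + (x2 - y2) = 0.
  apply: (invertible_mulI h2e); rewrite mulr0.
  transitivity ((x1 ^+ 2 + 2%:R * e * x1 + e ^+ 2 * x2 ^+ 2)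
    - (x1 ^+ 2 - 2%:R * e * x2 + e ^+ 2 * x2 ^+ 2)
    - ((y1 ^+ 2 + 2%:R * e * y1 + e ^+ 2 * y2 ^+ 2)
    - (y1 ^+ 2 - 2%:R * e * y2 + e ^+ 2 * y2 ^+ 2))); first by ring.
  by rewrite ex1 ex2 ey1 ey2 subrr.
have hx2 : x2 = y2 - (x1 - y1) by rewrite -[y2]addr0 -hs; ring.
(* This is the cofactor of [x1 - y1] in the difference of the second equations, once [x2 - y2] is
   replaced by [- (x1 - y1)]. It is congruent to 2 e because the unknowns are multiples of [p]. *)
have hi : invertible (2%:R * e + (x1 + y1 - e ^+ 2 * (x2 + y2))).
  apply: (invertible_pdvd h2e); rewrite addrC addKr.
  by apply: pdvdB; [|apply: pdvdMl]; apply: pdvdD.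
have h1 : x1 - y1 = 0.
  apply: (invertible_mulI hi); rewrite mulr0.
  transitivity ((x1 ^+ 2 + 2%:R * e * x1 + e ^+ 2 * x2 ^+ 2)
    - (y1 ^+ 2 + 2%:R * e * y1 + e ^+ 2 * y2 ^+ 2)); first by rewrite hx2; ring.
  by rewrite ex2 ey2 subrr.
by rewrite hx2 h1 subr0 -[x1](subrK y1) h1 add0r.
Qed.

End Uniqueness.

(** * Metricity and symmetry restricted to G' *)

Section LeviCivita.
Variables (phi : {rmorphism O -> O}) (deltaO : O -> O) (d : 'I_2 -> O).
Variable delta' : 'I_2 -> OG' -> OG'.
Hypotheses (p_pr : prime p) (deltaO_phi : frob p deltaO =1 phi).
Hypothesis LC : levi_civita_G' phi deltaO (fun i => (d i)%:M) delta'.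

Local Notation Phi i := (frob p (delta' i)).

Lemma LC_der i : p_derivation p (delta' i).
Proof. by case: LC. Qed.

Lemma LC_iota i c : Phi i (iota c) = iota (phi c).
Proof.
case: LC => _ [delta [res [[conn _ _] [res_iota _] res_delta]]].
rewrite /frob -res_iota res_delta (conn i).2 !res_iota.
by rewrite -deltaO_phi /frob rmorphD rmorphXn rmorphMn.
Qed.

(** Metricity is evaluated at the entry [0 0] of x: its image under H restricts to d_i (alpha^2 +
    beta^2), and [phi0] raises the entry to the [p]-th power. *)
Lemma LC_metric i :
  iota (phi (d i)) * (Phi i alpha ^+ 2 + Phi i beta ^+ 2) =
  iota (d i ^+ p) * (alpha ^+ 2 + beta ^+ 2) ^+ p.
Proof.
case: (LC) => der [delta [res [[conn met _] [res_iota res_x] res_delta]]].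
have [H [phi0 [[_ Hx] [_ _ phi0x] comm]]] := met i.
have res_frob f : res (frob p (delta i) f) = Phi i (res f).
  by rewrite /frob rmorphD rmorphXn rmorphMn res_delta.
have resx j k : res (xG p O j k) = mx_c alpha beta j k.
  by rewrite -res_x [RHS]mxE.
have resH : res (H (xG p O 0 0)) = iota (d i) * (alpha ^+ 2 + beta ^+ 2).
  have -> : H (xG p O 0 0) = (map_mx H (xG p O)) 0 0 by rewrite [RHS]mxE.
  rewrite Hx map_scalar_mx tr_mul_scalar_mulE rmorphM res_iota rmorphD.
  by rewrite !rmorphM !resx !mxE /= mulrNN !expr2.
have := comm (xG p O 0 0); move/(congr1 res).
have -> : phi0 (xG p O 0 0) = xG p O 0 0 ^+ p.
  have -> : phi0 (xG p O 0 0) = (map_mx phi0 (xG p O)) 0 0 by rewrite [RHS]mxE.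
  by rewrite phi0x mxE.
rewrite res_frob !rmorphXn resH exprMn => <-.
by rewrite frobM // frobD // !expr2 !frobM // LC_iota.
Qed.

Local Notation A := (alpha ^+ p).
Local Notation B := (beta ^+ p).

(** [Z i j] is the restriction of Gamma_ijk without its factor phi(d_i). Symmetry is vacuous for i =
    j, so the index pair (0, 1) carries all of it. *)
Lemma LC_symmetry k :
  let Z i j := delta' i (mx_c alpha beta 0 j) * mx_c alpha beta 0 k ^+ p +
               delta' i (mx_c alpha beta 1 j) * mx_c alpha beta 1 k ^+ p in
  iota (phi (d 0)) * Z 0 1 = iota (phi (d 1)) * Z 1 0.
Proof.
case: (LC) => der [delta [res [[_ _ sym] [res_iota res_x] res_delta]]] /=.
have resx j l : res (xG p O j l) = mx_c alpha beta j l.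
  by rewrite -res_x [RHS]mxE.
have resG i j : res (Gamma phi (d i)%:M (delta i) j k) =
    iota (phi (d i)) * (
      delta' i (mx_c alpha beta 0 j) * mx_c alpha beta 0 k ^+ p +
      delta' i (mx_c alpha beta 1 j) * mx_c alpha beta 1 k ^+ p).
  have -> : Gamma phi (d i)%:M (delta i) =
      (map_mx (delta i) (xG p O))^T *m (iotaG p (phi (d i)))%:M *m
      frob_mx p (xG p O).
    congr (_ *m _ *m _); exact: (map_scalar_mx (@iotaG p O \o phi)).
  rewrite tr_mul_scalar_mulE rmorphM res_iota; congr (_ * _).
  have hD j' : (map_mx (delta i) (xG p O)) j' j = delta i (xG p O j' j).
    by rewrite [LHS]mxE.
  have hX j' : frob_mx p (xG p O) j' k = xG p O j' k ^+ p by rewrite [LHS]mxE.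
  by rewrite !hD !hX rmorphD !rmorphM !rmorphXn -!res_delta !resx.
by rewrite -!resG sym.
Qed.

Hypothesis p_odd : odd p.

(** Multiplication by [p] turns [delta'] into [Phi] minus a [p]-th power. The bilinear expressions
    are entries of the transpose of c^(p) times Phi(c), where c is [mx_c alpha beta]; the first
    identity is the case k = 0, the second k = 1. *)
Lemma LC_symmetry_Phi :
  iota (phi (d 0)) * (A * Phi 0 beta - B * Phi 0 alpha) =
    iota (phi (d 1)) * (A * Phi 1 alpha + B * Phi 1 beta - (A ^+ 2 + B ^+ 2)) /\
  iota (phi (d 0)) * (A * Phi 0 alpha + B * Phi 0 beta - (A ^+ 2 + B ^+ 2)) =
    - (iota (phi (d 1)) * (A * Phi 1 beta - B * Phi 1 alpha)).
Proof.
have E k := congr1 (fun t => t *+ p) (LC_symmetry k).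
have := E 0; have := E 1; rewrite !mxE /= -!mulrnAr !mulrnDl -!mulrnAl.
rewrite !(delta_oppr_mulp p_pr (LC_der _)) // !delta_mulp.
rewrite [(- beta) ^+ p]exprNn -signr_odd p_odd expr1 mulN1r => e1 e0.
split; [move: e0|move: e1] => e; [transitivity (iota (phi (d 0)) *
  ((Phi 0 beta - B) * A + (Phi 0 alpha - A) * - B))|transitivity (iota (phi (d 0)) *
  ((Phi 0 beta - B) * B + (Phi 0 alpha - A) * A))]; try ring; rewrite e; ring.
Qed.

Hypothesis d_unit : forall i, d i \is a GRing.unit.

Lemma invertible_theta_den i : invertible (theta_den p phi (d i)).
Proof.
apply: invertibleM; first exact/invertible_iota/rmorph_unit.
exact: invertible_normp (LC_der 0).
Qed.

Lemma invertible_theta i : invertible (theta p phi (d i)).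
Proof.
apply: invertibleM; last exact/invertible_rinv/invertible_theta_den.
apply: invertibleM; last exact/invertibleX/invertible_norm.
by apply/invertible_iota; rewrite unitrX.
Qed.

Lemma LC_mx_c : exists u v : 'I_2 -> OG',
  [/\ forall i, Phi i alpha = A * u i - B * v i /\
                Phi i beta = A * v i + B * u i,
      forall i, pdvd p 1 (v i),
      forall i, u i ^+ 2 + v i ^+ 2 = theta p phi (d i)
    & iota (phi (d 0)) * v 0 = iota (phi (d 1)) * (u 1 - 1) /\
      iota (phi (d 0)) * (u 0 - 1) = - (iota (phi (d 1)) * v 1)].
Proof.
have [M] := invertible_normp p_pr (LC_der 0).
rewrite ![(2 * p)%N]mulnC !exprM => hM.
(* The witnesses are the entries of the inverse of c^(p) times Phi_i(c), by the adjugate formula;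
   [M] is the inverse of the determinant. *)
exists (fun i => M * (A * Phi i alpha + B * Phi i beta)).
exists (fun i => M * (A * Phi i beta - B * Phi i alpha)); split=> [i|i|i|].
- split; [rewrite -[LHS]mul1r|rewrite -[LHS]mul1r]; rewrite -hM; ring.
- apply: pdvdMl.
  (* The two products A B cancel, so only differences [Phi a - a ^+ p] remain. *)
  have -> : A * Phi i beta - B * Phi i alpha =
      A * (Phi i beta - B) - B * (Phi i alpha - A) by ring.
  by apply: pdvdB; apply/pdvdMl/frob_pdvd.
- apply: (invertible_mulI (invertible_theta_den i)).
  rewrite /theta [RHS]mulrCA rinvP ?mulr1; last exact: invertible_theta_den.
  rewrite -LC_metric /theta_den ![(2 * p)%N]mulnC !exprM.
  (* Writing 1 as the square of (A^2 + B^2) M matches the two factors [M] in u^2 + v^2; the rest is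
     the two-square identity. *)
  rewrite -[Phi i alpha ^+ 2 + _]mul1r -[1](expr1n _ 2) -hM; ring.
(* The bilinear expressions equal A^2 + B^2 times [v i] and [u i], so this unit can be cancelled. *)
have [e0 e1] := LC_symmetry_Phi.
split; apply: (invertible_mulI (ex_intro _ M hM)); rewrite -?hM.
  transitivity (((A ^+ 2 + B ^+ 2) * M) *
    (iota (phi (d 0)) * (A * Phi 0 beta - B * Phi 0 alpha))); first by ring.
  rewrite e0; ring.
transitivity (((A ^+ 2 + B ^+ 2) * M) * (iota (phi (d 0)) *
  (A * Phi 0 alpha + B * Phi 0 beta - (A ^+ 2 + B ^+ 2)))); first by ring.
rewrite e1; ring.
Qed.

End LeviCivita.

End G'.

Theorem proposition2p23 (p : nat) (O : idomainType)
    (phi : {rmorphism O -> O}) (deltaO : O -> O) (d : 'I_2 -> O)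
    (delta' : 'I_2 -> OG' p O -> OG' p O)
    (p_prime : prime p) (p_odd : odd p)
    (O_cdvr : complete_dvr p O) (O_perfect : perfect_residue_field p O)
    (phi_lift : frobenius_lift p phi)
    (deltaO_der : p_derivation p deltaO) (deltaO_phi : frob p deltaO =1 phi)
    (d_unit : forall i, d i \is a GRing.unit)
    (delta'_LC : levi_civita_G' phi deltaO (fun i => (d i)%:M) delta') :
  let alpha := alphaG' p O in
  let beta := betaG' p O in
  let eps := phi (d 1 / d 0) in
  [/\ eps \is a GRing.unit,
      forall i, invertible (theta_den p phi (d i)) /\
                invertible (theta p phi (d i)),
      exists! v : OG' p O * OG' p O, is_solution phi (d 0) (d 1) v
    & forall v1 v2 : OG' p O, is_solution phi (d 0) (d 1) (v1, v2) ->
      let u2 := 1 + iotaG' p eps^-1 * v1 in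
      let u1 := 1 - iotaG' p eps * v2 in
      map_mx (frob p (delta' 0)) (mx_c alpha beta) =
        mx_c (alpha ^+ p) (beta ^+ p) *m mx_c u1 v1 /\
      map_mx (frob p (delta' 1)) (mx_c alpha beta) =
        mx_c (alpha ^+ p) (beta ^+ p) *m mx_c u2 v2].
Proof.
move=> alpha beta eps.
have eps_unit : eps \is a GRing.unit.
  by rewrite rmorph_unit // unitrM unitrV !d_unit.
have [u [v [Phi_uv v_p uv_theta [ev eu]]]] :=
  LC_mx_c p_prime deltaO_phi delta'_LC p_odd d_unit.
have h0 : invertible (iotaG' p (phi (d 0))) by apply/invertible_iota/rmorph_unit.
have epsE : iotaG' p (phi (d 1)) = iotaG' p (phi (d 0)) * iotaG' p eps.
  by rewrite -!rmorphM [d 0 * _]mulrC divrK.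
have {}ev : v 0 = iotaG' p eps * (u 1 - 1).
  by apply: (invertible_mulI h0); rewrite ev epsE mulrA.
have {}eu : u 0 = 1 - iotaG' p eps * v 1.
  apply/(addIr (-1))/(invertible_mulI h0).
  by rewrite eu epsE addrAC subrr add0r mulrN mulrA.
have u1E : u 1 = 1 + iotaG' p eps^-1 * v 0.
  by rewrite ev mulrA [X in X * _]mulrC iota_mulV // mul1r addrC subrK.
(* Existence comes from the connection itself, without successive approximation: both equations are
   norm relations u^2 + v^2 = theta, the second scaled by the square of [eps], after eliminating
   [u]. *)
have sol : is_solution phi (d 0) (d 1) (v 0, v 1).
  split=> //=; rewrite -/eps -!uv_theta; first by rewrite eu; ring.
  by rewrite ev; ring.
have uniq := solution_uniq p_odd O_cdvr (d_unit 0) (d_unit 1) sol.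
(* Uniqueness identifies an arbitrary solution with the pair read off from the connection. *)
split=> // [i||v1 v2 /uniq[<- <-] u2 u1].
- by split; [apply: invertible_theta_den delta'_LC _ _
            |apply: invertible_theta delta'_LC _ _].
- by exists (v 0, v 1).
have der i := LC_der delta'_LC i.
have frob_mx_c i : map_mx (frob p (delta' i)) (mx_c alpha beta) =
    mx_c (alpha ^+ p) (beta ^+ p) *m mx_c (u i) (v i).
  have [ea eb] := Phi_uv i.
  have frobNb : frob p (delta' i) (- beta) = - frob p (delta' i) beta.
    exact: frobN.
  apply/matrixP => j k; rewrite !mxE !big_ord_recl big_ord0 !mxE addr0.
  by case: j k => [[|[|//]] ?] [[|[|//]] ?] /=; rewrite ?frobNb ?ea ?eb; ring.
by rewrite !frob_mx_c /u1 /u2 eu u1E.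
Qed.
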